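(* Let $x(j)$, $j=0,1,2,\dots$, be integers with $x(0)=1$, and with $x(1)$ and $x(2)$ odd. Let the integers $v_{\mathbf x}(n)$ be defined by $$\sum_{n\ge0}\frac{v_{\mathbf x}(n)}{2^n\,(2n)!}t^{2n}=\Bigl(1+\sum_{j\ge1}\frac{x(j)}{(2j)!}t^{2j}\Bigr)^{1/2}.$$ Then the sequence $(v_{\mathbf x}(n))_{n\ge0}$, when taken modulo $2$, is the all-$1$-sequence. Modulo $4$, the sequence is purely periodic with period length $4$, the first few values of the sequence (modulo $4$) being given by $$1,\ x(1),\ 3,\ x(1)+2,\ 1,\ \dots.$$
   Context: The square root denotes the formal power series square root with constant term $1$. A sequence $(a(n))_{n\ge0}$ is purely periodic modulo $M$ with period length $L$ if $a(n+L)\equiv a(n)\pmod M$ for all $n\ge0$. *)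

(* Defs.v *)
From mathcomp Require Import all_boot all_order all_algebra.

Set Implicit Arguments.
Unset Strict Implicit.
Unset Printing Implicit Defensive.

Import GRing.Theory Num.Theory.
Local Open Scope ring_scope.

(* A formal power series over Q, as its coefficient sequence: f n = [t^n] f. *)
Definition fps := nat -> rat.

Definition fps_mul (f g : fps) : fps :=
  fun n => \sum_(i < n.+1) f i * g (n - i)%N.

Definition is_fps_sqrt (f g : fps) : Prop :=
  g 0%N = 1 /\ fps_mul g g =1 f.

(* \sum_n c n * t^(2n) *)
Definition even_fps (c : nat -> rat) : fps :=
  fun m => if odd m then 0 else c m./2.

(* The constant term of this series is x 0, which is meant to be 1. *)
Definition x_series (x : nat -> int) : fps :=
  even_fps (fun j => (x j)%:~R / (j.*2)`!%:R).

Definition v_series (v : nat -> int) : fps :=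
  even_fps (fun n => (v n)%:~R / (2 ^+ n * (n.*2)`!%:R)).

Definition is_v (x v : nat -> int) : Prop :=
  is_fps_sqrt (x_series x) (v_series v).

Definition purely_periodic_mod (a : nat -> int) (M : int) (L : nat) : Prop :=
  forall n : nat, (a (n + L)%N = a n %[mod M])%Z.

Lemma fps_sqrt_unique (f g h : fps) :
  is_fps_sqrt f g -> is_fps_sqrt f h -> g =1 h.
Proof.
move=> [g0 gg] [h0 hh] m; elim/ltn_ind: m => -[|m] IH; first by rewrite g0 h0.
have mulE (k : fps) : k 0%N = 1 -> fps_mul k k m.+1 =
    k m.+1 *+ 2 + \sum_(i < m) k i.+1 * k (m - i)%N.
  move=> k0; rewrite /fps_mul big_ord_recl big_ord_recr /= subn0 /bump /= add1n.
  rewrite subnn k0 mul1r mulr1 addrCA mulr2n [RHS]addrC addrA.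
  by congr (_ + _ + _); apply: eq_bigr => i _; rewrite add1n subSS.
have := gg m.+1; rewrite -hh !mulE // (eq_bigr (fun i : 'I_m =>
    h i.+1 * h (m - i)%N)); last by move=> i _; rewrite !IH ?ltnS ?leq_subr.
by move=> /addIr/eqP; rewrite eqr_pMn2r // => /eqP.
Qed.

(* Main.v *)
Require Import Defs.
From mathcomp Require Import all_boot all_order all_algebra all_field.
From mathcomp Require Import ring zify.
Import GRing.Theory Num.Theory.
Local Open Scope ring_scope.

(** Comparing coefficients of t^(2n) in the square of the series of v, the claim
    that v gives the square root becomes the quadratic recurrence
    [sum_i C(2n,2i) v(i) v(n-i) = 2^n x(n)] for all n, whose left-hand side is
    [binomial_conv v n] ([is_v_of_conv]).  Its two end terms contribute 2 v(n), so
    it determines v(n) from the earlier values, but only after a division by 2.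

    The idea is to exhibit the expected residues as an exact integer sequence,
    [model a n = a^n (-1)^(n/2)] (integer part of n/2) with a = x(1), and to show
    that it satisfies the same recurrence modulo 8.  The sign of the product
    model(i) model(n-i) is constant in i when n is odd, and alternates with i when n
    is even.  Hence its convolution is, up to a sign and the factor a^n, the sum of
    the C(2n,2i), which is a power of two, or the sum of the (-1)^i C(2n,2i), which
    is the real part of (1 + 'i)^(2n) = (2 'i)^n, up to sign 2^n as n is even.
    Both closed forms agree with 2^n x(n) modulo 8: for n >= 3 all are 0, and for
    n <= 2 this uses x(0) = 1, a = x(1), and that x(1) and x(2) are odd
    ([model_conv_mod8]).

    Knowing v modulo 4 below n is enough to know the inner part of the
    convolution modulo 8, because the terms i and n-i are equal and so every
    error is doubled ([binomial_conv_inner_congr]).  By strong induction 2 v(n) is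
    then congruent to 2 model(n) modulo 8, so that at once the division by 2 is
    exact and v(n) is congruent to model(n) modulo 4 ([sqrt_step_model]).  For odd
    a the model has odd values and period 4 modulo 4, as a^2 = 1 modulo 8. *)

(** * The square root as a quadratic recurrence *)

Lemma sum_even_support (V : nmodType) (F : nat -> V) (n : nat) :
  (forall i, odd i -> F i = 0) ->
  \sum_(i < n.*2.+1) F i = \sum_(i < n.+1) F i.*2.
Proof.
move=> F0; elim: n => [|n IHn]; first by rewrite !big_ord1.
rewrite doubleS big_ord_recr big_ord_recr /= IHn [RHS]big_ord_recr /=.
by rewrite F0 ?addr0 //= odd_double.
Qed.

Definition binomial_conv (f : nat -> int) (n : nat) : int :=
  \sum_(i < n.+1) 'C(n.*2, i.*2)%:R * (f i * f (n - i)%N).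

Definition binomial_conv_inner (f : nat -> int) (n : nat) : int :=
  \sum_(1 <= i < n) 'C(n.*2, i.*2)%:R * (f i * f (n - i)%N).

Lemma binomial_conv_ends (f : nat -> int) (n : nat) : f 0%N = 1 -> (0 < n)%N ->
  binomial_conv f n = f n *+ 2 + binomial_conv_inner f n.
Proof.
move=> f0; case: n => // n _.
rewrite /binomial_conv /binomial_conv_inner big_ord_recl big_ord_recr /=.
rewrite big_add1 /= big_mkord subn0 subnn f0 bin0 binn.
rewrite [bump 0 n]add1n.
by set S := \sum_(i < n) _; ring.
Qed.

(** The coefficient of t^(2n) in the square of the series of v is
    [binomial_conv v n / (2^n (2n)!)], since (2n)! / ((2i)! (2n-2i)!) = C(2n,2i)
    and the powers of two multiply to 2^n. *)
Lemma is_v_of_conv (x v : nat -> int) : v 0%N = 1 ->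
  (forall n, binomial_conv v n = 2 ^+ n * x n) -> is_v x v.
Proof.
move=> v0 conv; split; first by rewrite /v_series /even_fps /= v0.
move=> m; rewrite /x_series [RHS]/even_fps /fps_mul.
case: ifPn => [m_odd | /negbTE m_even].
  apply: big1 => i _; rewrite /v_series /even_fps.
  case: ifP => [_ | i_even]; first by rewrite mul0r.
  by rewrite oddB ?m_odd ?i_even ?mulr0 // -ltnS ltn_ord.
have -> : m = m./2.*2 by rewrite even_halfK ?m_even.
move: m./2 => n; rewrite doubleK.
rewrite (sum_even_support _ (fun i => v_series v i * v_series v (n.*2 - i)%N));
  last by move=> i i_odd; rewrite /v_series /even_fps i_odd mul0r.
have fact_neq0 k : k`!%:R != 0 :> rat by rewrite pnatr_eq0 -lt0n fact_gt0.
have pow2_neq0 k : 2 ^+ k != 0 :> rat by rewrite expf_neq0.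
transitivity ((binomial_conv v n)%:~R / (2 ^+ n * n.*2`!%:R) : rat); last first.
  rewrite conv rmorphM rmorphXn /=; field.
  by rewrite pow2_neq0 fact_neq0.
rewrite /binomial_conv rmorph_sum mulr_suml; apply: eq_bigr => -[i] /= + _.
rewrite ltnS => le_in.
rewrite /v_series /even_fps -doubleB !odd_double !doubleK !rmorphM /=.
rewrite rmorph_nat -(bin_fact (m := i.*2) (n := n.*2)) ?leq_double //.
rewrite -doubleB !natrM -[in RHS](subnKC le_in) exprD subnKC //.
have bin_neq0 : 'C(n.*2, i.*2)%:R != 0 :> rat.
  by rewrite pnatr_eq0 -lt0n bin_gt0 leq_double.
by field; rewrite ?pow2_neq0 ?fact_neq0 ?bin_neq0.
Qed.

(** * The model sequence *)

(** Adding the two expansions cancels the odd powers of y. *)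
Lemma sum_even_binomial (R : comNzRingType) (y : R) (n : nat) :
  (1 + y) ^+ n.*2 + (1 - y) ^+ n.*2 =
  (\sum_(i < n.+1) 'C(n.*2, i.*2)%:R * (y ^+ 2) ^+ i) *+ 2.
Proof.
rewrite !exprDn -big_split /=.
rewrite (sum_even_support _ (fun i => 1 ^+ (n.*2 - i) * y ^+ i *+ 'C(n.*2, i)
   + 1 ^+ (n.*2 - i) * (- y) ^+ i *+ 'C(n.*2, i))); last first.
  by move=> i i_odd; rewrite exprNn -signr_odd i_odd expr1 mulN1r mulrN mulNrn subrr.
rewrite -sumrMnl; apply: eq_bigr => i _.
rewrite exprNn -signr_odd odd_double mul1r expr1n mul1r -mulr2n.
by rewrite -exprM mul2n mulr_natl.
Qed.

Lemma sum_even_binomial1 (n : nat) :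
  (\sum_(i < n.+2) 'C(n.+1.*2, i.*2)%:R : int) = 2 ^+ n.*2.+1.
Proof.
apply: (@pmulrnI int 2) => //.
have := sum_even_binomial int 1 n.+1.
rewrite subrr expr0n addr0 => sumE.
rewrite -[RHS]mulr_natr -exprSr -doubleS [RHS]sumE.
by congr (_ *+ _); apply: eq_bigr => i _; rewrite !expr1n mulr1.
Qed.

(** The case y = 'i of [sum_even_binomial], where both (1 + 'i)^4 and
    (1 - 'i)^4 equal -4. *)
Lemma sum_even_binomial_sign (m : nat) :
  (\sum_(i < m.*2.+1) 'C(m.*2.*2, i.*2)%:R * (-1) ^+ i : int) = (-4) ^+ m.
Proof.
apply: (@intr_inj algC); apply: (@pmulrnI algC 2) => //.
rewrite rmorphXn rmorph_sum /=.
have := sum_even_binomial algC 'i m.*2; rewrite sqrCi.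
have pow4 (y : algC) : y ^+ 2 = -1 -> (1 + y) ^+ m.*2.*2 = (-4) ^+ m.
  move=> y2; rewrite -!muln2 -mulnA mulnC exprM; congr (_ ^+ _).
  transitivity ((1 + y ^+ 2 + y *+ 2) ^+ 2); first by ring.
  rewrite y2 subrr add0r; transitivity (y ^+ 2 * 4); first by ring.
  by rewrite y2; ring.
rewrite !pow4 ?sqrrN ?sqrCi //.
rewrite -mulr2n mulrNz => sumE; rewrite [RHS]sumE; congr (_ *+ _).
by apply: eq_bigr => i _; rewrite rmorphM rmorph_nat rmorphXn.
Qed.

(** For odd a this is 1, a, 3, a + 2 modulo 4, continued periodically.  The factor
    a^n, rather than just a at odd n, makes a come out of every convolution. *)
Definition model (a : int) (n : nat) : int := a ^+ n * (-1) ^+ n./2.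

Lemma binomial_conv_model_even (a : int) (m : nat) :
  binomial_conv (model a) m.*2 = a ^+ m.*2 * 4 ^+ m.
Proof.
transitivity (a ^+ m.*2 * ((-1) ^+ m *
    \sum_(i < m.*2.+1) 'C(m.*2.*2, i.*2)%:R * (-1) ^+ i : int)); last first.
  by rewrite sum_even_binomial_sign -exprMn.
rewrite mulrA mulr_sumr; apply: eq_bigr => -[i] /= + _; rewrite ltnS => le_i.
rewrite /model mulrACA -exprD subnKC // -exprD.
suff -> : (-1) ^+ (i./2 + (m.*2 - i)./2) = (-1) ^+ m * (-1) ^+ i :> int by ring.
rewrite -exprD -signr_odd -[RHS]signr_odd; congr (_ ^+ nat_of_bool _); lia.
Qed.

Lemma binomial_conv_model_odd (a : int) (m : nat) :
  binomial_conv (model a) m.*2.+1 = a ^+ m.*2.+1 * (-1) ^+ m * 2 ^+ m.*2.*2.+1.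
Proof.
rewrite -sum_even_binomial1 mulr_sumr; apply: eq_bigr => -[i] /= + _.
rewrite ltnS => le_i; rewrite /model mulrACA -exprD subnKC // -exprD.
have -> : (i./2 + (m.*2.+1 - i)./2)%N = m by lia.
by ring.
Qed.

(** * The recurrence modulo 8 *)

Lemma odd_sqr_mod8 (a : int) : ~~ (2 %| a)%Z -> (8 %| a ^+ 2 - 1)%Z.
Proof.
move=> a_odd; have [k ->] : exists k : int, a = k * 2 + 1.
  by exists (a %/ 2)%Z; lia.
have [j kE] : exists j : int, k * (k + 1) = j * 2.
  have [h [-> | ->]] : exists h : int, k = h * 2 \/ k = h * 2 + 1.
  - by exists (k %/ 2)%Z; lia.
  - by exists (h * (h * 2 + 1)); ring.
  by exists ((h * 2 + 1) * (h + 1)); ring.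
apply/dvdzP; exists j; transitivity (k * (k + 1) * 4 : int); first by ring.
by rewrite kE; ring.
Qed.

Lemma dvd8_pow2_sub (k l : nat) (y z : int) : (2 < k)%N -> (2 < l)%N ->
  (8 %| 2 ^+ k * y - z * 2 ^+ l)%Z.
Proof.
move=> /subnKC <- /subnKC <-; rewrite !exprD.
apply/dvdzP; exists (2 ^+ (k - 3) * y - z * 2 ^+ (l - 3)).
by move: (2 ^+ (k - 3)) (2 ^+ (l - 3)) => p q; ring.
Qed.

(** Only the indices 0, 1, 2 involve the hypotheses on x: there the closed forms
    1, 2a and 4a^2 have to match 1, 2x(1) and 4x(2).  For larger n both sides
    are multiples of 8. *)
Lemma model_conv_mod8 (x : nat -> int) (n : nat) :
  x 0%N = 1 -> ~~ (2 %| x 1%N)%Z -> ~~ (2 %| x 2%N)%Z ->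
  (8 %| 2 ^+ n * x n - binomial_conv (model (x 1%N)) n)%Z.
Proof.
move=> x0 x1_odd x2_odd; set a := x 1%N.
have [m ->] : exists m, n = (odd n + m.*2)%N by exists n./2; rewrite odd_double_half.
case: (odd n); last first.
  rewrite add0n binomial_conv_model_even.
  have aX_mod8 : (8 %| a ^+ m.*2 - 1)%Z.
    rewrite -mul2n exprM subrX1 dvdz_mulr //; exact: odd_sqr_mod8.
  case: m aX_mod8 => [|[|m]] aX_mod8.
  - by rewrite x0.
  - have -> : 2 ^+ 1.*2 = 4 :> int by [].
    by move: aX_mod8 x2_odd; rewrite expr1 -[1.*2]/2%N; move: (a ^+ 2) (x 2); lia.
  (* n = 2m with m >= 2: the exponent of two is already at least 4. *)
  have -> : 4 ^+ m.+2 = 2 ^+ m.+2.*2 :> int by rewrite -mul2n exprM.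
  exact: dvd8_pow2_sub.
rewrite add1n binomial_conv_model_odd; case: m => [|m].
  by rewrite /= -/a !expr1 expr0 mulr1 mulrC subrr.
exact: dvd8_pow2_sub.
Qed.

(** Writing f = g + 4d, the terms linear in d are 4 times two sums that are equal
    by the symmetry i <-> n - i, hence a multiple of 8, and the quadratic ones
    carry a factor 16.  This gain of a factor 2 is what pays for the division by 2
    in the recurrence. *)
Lemma binomial_conv_inner_congr (f g : nat -> int) (n : nat) :
  (forall i, (0 < i < n)%N -> (4 %| f i - g i)%Z) ->
  (8 %| binomial_conv_inner f n - binomial_conv_inner g n)%Z.
Proof.
move=> fg; pose d i := ((f i - g i) %/ 4)%Z.
have fE i : (0 < i < n)%N -> f i = g i + d i * 4.
  by move=> i_in; rewrite /d divzK ?fg // addrC subrK.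
pose c i : int := 'C(n.*2, i.*2)%:R.
pose S := \sum_(1 <= i < n) c i * (d i * g (n - i)%N).
pose T := \sum_(1 <= i < n) c i * (d i * d (n - i)%N).
have S_rev : \sum_(1 <= i < n) c i * (g i * d (n - i)%N) = S.
  rewrite big_nat_rev /=; apply: eq_big_nat => i /andP[_ lt_in].
  rewrite add1n subSS subKn 1?ltnW //.
  have -> : c (n - i)%N = c i.
    by rewrite /c doubleB bin_sub // leq_double ltnW.
  by rewrite [g _ * _]mulrC.
suff -> : binomial_conv_inner f n = binomial_conv_inner g n + (S + T * 2) * 8.
  by rewrite addrC addKr dvdz_mull.
transitivity (binomial_conv_inner g n + S * 4 +
    (\sum_(1 <= i < n) c i * (g i * d (n - i)%N)) * 4 + T * 16); last first.
  by rewrite S_rev; ring.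
rewrite !mulr_suml -!big_split /=; apply: eq_big_nat => i i_in.
by rewrite !fE ?subn_gt0 ?ltn_subrL; [rewrite /c; ring | lia | lia].
Qed.

(** * Solving the recurrence *)

(** The solution is the diagonal of the iterates of [step]: the n-th value no longer
    changes after n + 1 iterations. *)
Lemma course_of_values (T : Type) (t0 : T) (step : nat -> (nat -> T) -> T) :
  (forall n f g, (forall i, (i < n)%N -> f i = g i) -> step n f = step n g) ->
  exists f, forall n, f n = step n f.
Proof.
move=> step_ext; pose approx k := iter k (fun f n => step n f) (fun=> t0).
have stable n k : (n < k)%N -> approx k n = approx n.+1 n.
  elim/ltn_ind: n k => n IHn [//|k] lt_nk /=.
  by apply: step_ext => i lt_in; rewrite [RHS]IHn // IHn // (leq_trans lt_in).
exists (fun n => approx n.+1 n) => n /=.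
by apply: step_ext => i lt_in; rewrite stable.
Qed.

Definition sqrt_step (x : nat -> int) (n : nat) (v : nat -> int) : int :=
  if n is 0 then 1 else ((2 ^+ n * x n - binomial_conv_inner v n) %/ 2)%Z.

(** The Euclidean quotient in [sqrt_step] is exact: by the two congruences modulo 8
    its numerator is 2 model(n) modulo 8, provided that v is congruent to the model
    modulo 4 below n.  Halving then gives that congruence at n. *)
Lemma sqrt_step_model (x v : nat -> int) :
  x 0%N = 1 -> ~~ (2 %| x 1%N)%Z -> ~~ (2 %| x 2%N)%Z ->
  (forall n, v n = sqrt_step x n v) ->
  forall n, (4 %| v n - model (x 1%N) n)%Z /\ binomial_conv v n = 2 ^+ n * x n.
Proof.
move=> x0 x1_odd x2_odd vE; set w := model (x 1%N).
have v0 : v 0%N = 1 by rewrite vE.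
have w0 : w 0%N = 1 by rewrite /w /model !expr0 mulr1.
elim/ltn_ind=> -[|n] IHn.
  by rewrite v0 w0 subrr dvdz0 /binomial_conv big_ord1 v0 x0.
have := model_conv_mod8 x n.+1 x0 x1_odd x2_odd.
have /binomial_conv_inner_congr :
    forall i, (0 < i < n.+1)%N -> (4 %| v i - w i)%Z.
  by move=> i /andP[_ /IHn[]].
rewrite !binomial_conv_ends // [v n.+1]vE /sqrt_step -/w.
by move: (binomial_conv_inner _ _) (binomial_conv_inner _ _) (_ * _); lia.
Qed.

Theorem theorem32 (x : nat -> int)
    (hx0 : x 0%N = 1) (hx1 : ~~ (2 %| x 1%N)%Z) (hx2 : ~~ (2 %| x 2%N)%Z) :
  (exists v : nat -> int, is_v x v) /\
  (forall v : nat -> int, is_v x v ->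
    [/\ forall n : nat, (v n = 1 %[mod 2])%Z,
        purely_periodic_mod v 4 4
      & [/\ (v 0%N = 1 %[mod 4])%Z,
            (v 1%N = x 1%N %[mod 4])%Z,
            (v 2%N = 3 %[mod 4])%Z,
            (v 3%N = x 1%N + 2 %[mod 4])%Z
          & (v 4%N = 1 %[mod 4])%Z]]).
Proof.
have [v vE] : exists v : nat -> int, forall n, v n = sqrt_step x n v.
  apply: (course_of_values int 0 (sqrt_step x)) => -[//|n] f g fg.
  congr ((_ - _) %/ _)%Z; apply: eq_big_nat => i i_in.
  by rewrite !fg //; lia.
have v_conv := sqrt_step_model x v hx0 hx1 hx2 vE.
have v_sqrt : is_v x v by apply: is_v_of_conv => [|n]; [rewrite vE | case: (v_conv n)].
split; first by exists v.
(* By uniqueness of the square root, it suffices to study the constructed v. *)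
move=> u u_sqrt; have uE n : u n = v n.
  have /(_ n.*2) := fps_sqrt_unique u_sqrt v_sqrt.
  rewrite /v_series /even_fps odd_double doubleK => /mulIf.
  rewrite invr_eq0 mulf_neq0 ?expf_neq0 ?pnatr_eq0 -?lt0n ?fact_gt0 //.
  by move=> /(_ isT)/intr_inj.
have u_mod4 n : exists k : int, u n = k * 4 + model (x 1%N) n.
  by rewrite uE; have [/dvdzP[k kE] _] := v_conv n; exists k; rewrite -kE subrK.
have [j sqr_x1] : exists j : int, x 1%N ^+ 2 = j * 8 + 1.
  by have /dvdzP[j jE] := odd_sqr_mod8 _ hx1; exists j; rewrite -jE subrK.
split.
- move=> n; have [k ->] := u_mod4 n.
  have : ~~ (2 %| model (x 1%N) n)%Z.
    rewrite /model mulrC rpredMsign dvdzE abszX Euclid_dvdX // negb_and.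
    by rewrite -dvdzE hx1.
  by move: (model _ _); lia.
- move=> n; have [k ->] := u_mod4 n; have [l ->] := u_mod4 (n + 4)%N.
  have -> : model (x 1%N) (n + 4) = (x 1%N ^+ 2) ^+ 2 * model (x 1%N) n.
    rewrite /model halfD andbF add0n -[4./2]/2%N !exprD.
    by ring.
  by rewrite sqr_x1; move: (model _ _) => w; lia.
have [[k0 ->] [k1 ->] [k2 ->] [k3 ->] [k4 ->]] :=
  And5 (u_mod4 0%N) (u_mod4 1%N) (u_mod4 2%N) (u_mod4 3%N) (u_mod4 4%N).
rewrite /model /= (exprM _ 2 2) (exprD _ 2 1) sqr_x1 !expr1 expr0 !mulr1.
split; lia.
Qed.
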